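(* Let $X$ be a crowded topological space which is either (a) locally compact, Hausdorff and second-countable, or (b) completely metrizable and of cardinality $\mathfrak c=2^{\aleph_0}$. Then $X$ is Baire $\mathfrak c$-resolvable: there is a partition $\{A_\iota:\iota<\mathfrak c\}$ of $X$ such that for every $\iota$ and every nonempty open $U\subseteq X$, the set $A_\iota\cap U$ is not meager.
   Context: Crowded means having no isolated points. A set is meager if it is a countable union of nowhere dense sets (sets whose closure has empty interior). *)

(* Defs.v *)
From HB Require Import structures.
From mathcomp Require Import all_boot all_order all_algebra.
From mathcomp Require Import all_classical all_reals.
From mathcomp Require Import topology.

Set Implicit Arguments.
Unset Strict Implicit.
Unset Printing Implicit Defensive.

Import Order.TTheory GRing.Theory Num.Theory.

Local Open Scope classical_set_scope.
Local Open Scope ring_scope.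

Definition crowded (X : topologicalType) : Prop := isolated [set: X] = set0.

Definition nowhere_dense (X : topologicalType) (A : set X) : Prop :=
  interior (closure A) = set0.

(* Finite unions are covered by padding with the empty set, which is nowhere
   dense. *)
Definition meager (X : topologicalType) (A : set X) : Prop :=
  exists2 F : nat -> set X,
    forall n, nowhere_dense (F n) & A = \bigcup_n F n.

Definition is_metric (R : realType) (X : Type) (d : X -> X -> R) : Prop :=
  [/\ forall x y, 0 <= d x y,
      forall x y, d x y = 0 <-> x = y,
      forall x y, d x y = d y x &
      forall x y z, d x z <= d x y + d y z].

Definition metric_induces_topology (R : realType) (X : topologicalType)
    (d : X -> X -> R) : Prop :=
  forall U : set X, open U <->
    forall x, U x -> exists2 e : R, 0 < e & [set y | d x y < e] `<=` U.

Definition metric_cauchy_seq (R : realType) (X : Type) (d : X -> X -> R)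
    (u : nat -> X) : Prop :=
  forall e : R, 0 < e ->
    exists N : nat, forall m n, (N <= m)%N -> (N <= n)%N -> d (u m) (u n) < e.

Definition metric_cvg_seq (R : realType) (X : Type) (d : X -> X -> R)
    (u : nat -> X) (l : X) : Prop :=
  forall e : R, 0 < e -> exists N : nat, forall n, (N <= n)%N -> d (u n) l < e.

Definition metric_complete (R : realType) (X : Type) (d : X -> X -> R) : Prop :=
  forall u : nat -> X, metric_cauchy_seq d u -> exists l, metric_cvg_seq d u l.

(* The library's completeType and metricType carry a chosen uniformity or
   distance (and completeType a base point), whereas here the topology of X is
   given and a compatible complete metric is only required to exist. *)
Definition completely_metrizable (R : realType) (X : topologicalType) : Prop :=
  exists d : X -> X -> R,
    [/\ is_metric d, metric_induces_topology d & metric_complete d].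

(* A type of cardinality 2^aleph_0, also used in place of the ordinals below
   the continuum to index the pieces of a partition. *)
Definition continuum : Type := nat -> bool.

Definition has_card_continuum (X : Type) : Prop :=
  ([set: X] #= [set: continuum])%card.

(* The library's [partition] also asks every piece to be nonempty. For nonempty
   X this follows from the last clause with U = X; omitting it only serves to
   include the empty space. *)
Definition Baire_resolvable (I : Type) (X : topologicalType) : Prop :=
  exists A : I -> set X,
    [/\ trivIset [set: I] A,
        cover [set: I] A = [set: X] &
        forall (i : I) (U : set X), open U -> U !=set0 -> ~ meager (A i `&` U)].

(* Main.v *)
Require Import Defs.
From Stdlib Require Wellfounded.
From mathcomp Require Import all_boot all_order all_algebra.
From mathcomp Require Import all_classical all_reals.
From mathcomp Require Import topology cantor wochoice lra.

(** A Bernstein-type construction. Let [U] be open and nonempty and [M] meager.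
    A Cantor scheme of open sets avoiding the nowhere dense pieces of [M] yields
    a continuous injection of the Cantor space into [U \ M]; completeness enters
    only in making the sets along each branch shrink to a point. A continuous
    map into a Hausdorff space is determined by its values on the eventually
    zero sequences, so a space with at most continuum many points contains at
    most continuum many copies of the Cantor space, each with continuum many
    points. Transfinite recursion along a well-order with small initial segments
    then picks pairwise distinct points, one in the copy [K] for each pair
    [(K, i)], and the piece with index [i] collects the points picked for [i].
    Counting Cantor sets rather than G_delta sets is what makes the argument
    work for non-separable [X]. *)

Set Implicit Arguments.
Unset Strict Implicit.
Unset Printing Implicit Defensive.

Import Order.TTheory GRing.Theory Num.Theory.

Local Open Scope classical_set_scope.
Local Open Scope card_scope.

(** * Cardinals and well-orders *)

Lemma card_le_setTP (T X : Type) (S : set X) :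
  reflect (exists2 f : T -> X, injective f & forall t, S (f t))
          ([set: T] #<= S).
Proof.
apply: (iffP idP) => [/card_leP[f]|[f finj fS]].
  pose inT (t : T) : [set: T] := SigSub (in_setT t).
  exists (fun t => set_val (f (inT t))) => [s t /val_inj fst|t].
    by have /(congr1 val) := @inj _ _ _ f (inT s) (inT t) (in_setT _)
      (in_setT _) fst.
  exact/set_mem/(svalP (f (inT t))).
have /injfunPex[g] : exists2 g : T -> X, set_fun setT S g & set_inj setT g.
  by exists f => // s t _ _; exact: finj.
exact: inj_card_le g.
Qed.

Section well_founded_relations.
Variables (T : Type) (lt : T -> T -> Prop).
Hypothesis lt_wf : well_founded lt.

Lemma well_founded_min (P : set T) : P !=set0 ->
  exists2 t, P t & forall s, lt s t -> ~ P s.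
Proof.
move=> [t]; elim/(well_founded_ind lt_wf): t => t IH Pt.
have [[s [lt_st Ps]]|minimal_t] := pselect (exists s, lt s t /\ P s).
  exact: IH Ps.
by exists t => // s lt_st Ps; apply: minimal_t; exists s.
Qed.

Lemma well_founded_choice (X : Type)
    (P : forall t, (forall s, lt s t -> X) -> X -> Prop) :
  (forall t g, exists x, P t g x) ->
  exists f : T -> X, forall t, P t (fun s _ => f s) (f t).
Proof.
move=> exP; pose f := Fix lt_wf (fun=> X) (fun t g => sval (cid (exP t g))).
exists f => t; rewrite {2}/f Fix_eq; first exact: svalP (cid _).
move=> {}t u v uv; congr (sval (cid (exP t _))).
by do 2!apply: functional_extensionality_dep => ?.
Qed.

End well_founded_relations.

Definition strict_well_order (T : Type) (lt : T -> T -> Prop) : Prop :=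
  well_founded lt /\ forall x y, x <> y -> lt x y \/ lt y x.

Lemma exists_strict_well_order (T : Type) :
  exists lt : T -> T -> Prop, strict_well_order lt.
Proof.
have [R wR] := @well_ordering_principle {classic T}.
have R_total : total R.
  by move=> x y; exact: (@wo_chainW _ R predT (withinW wR)).
have R_anti : antisymmetric R.
  by move=> x y; exact: (@wo_chain_antisymmetric _ R predT (withinW wR)).
pose lt (x y : T) := R x y /\ x <> y.
exists lt; split=> [x|x y xy]; last first.
  have /orP[Rxy|Ryx] := R_total x y; [by left|right].
  by split=> // /esym.
apply: contrapT => nAx.
have [|z [[/asboolP nAz zmin] _]] := wR [pred y | `[< ~ Acc lt y >]].
  by exists x; apply/asboolP.
apply: nAz; constructor => y [Ryz yz]; apply: contrapT => nAy.
by apply: yz; apply: R_anti; rewrite Ryz zmin//; apply/asboolP.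
Qed.

(* If some initial segment is as large as [T], pull the order back along an
   embedding of [T] into the least such segment. *)
Lemma exists_initial_well_order (T : Type) :
  exists2 lt : T -> T -> Prop, strict_well_order lt &
    forall t, ~ ([set: T] #<= [set s | lt s t]).
Proof.
have [lt [lt_wf lt_total]] := exists_strict_well_order T.
pose large := [set t | [set: T] #<= [set s | lt s t]].
have [ex_large|no_large] := pselect (large !=set0); last first.
  by exists lt => // t large_t; apply: no_large; exists t.
have [t /= /card_le_setTP[g g_inj g_lt] t_min] :=
  well_founded_min lt_wf ex_large.
exists (fun x y => lt (g x) (g y)).
  split; first exact: Inverse_Image.wf_inverse_image.
  by move=> x y xy; apply: lt_total => /g_inj.
move=> s /card_le_setTP[h h_inj h_lt]; apply: (t_min (g s) (g_lt s)) => /=.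
by apply/card_le_setTP; exists (g \o h) => //; exact: inj_comp.
Qed.

Lemma exists_injective_choice (T X : Type) (F : T -> set X) :
  (forall t, [set: T] #<= F t) ->
  exists2 f : T -> X, injective f & forall t, F t (f t).
Proof.
move=> F_large.
have [lt [lt_wf lt_total] lt_small] := exists_initial_well_order T.
have [t g|f fP] := @well_founded_choice _ _ lt_wf X
    (fun t g x => F t x /\ forall s (lt_st : lt s t), g s lt_st <> x).
  have /card_le_setTP[h h_inj hF] := F_large t.
  apply: contrapT => exhausted.
  have /choice[k kP] s : exists r, exists lt_rt : lt r t, g r lt_rt = h s.
    apply: contrapT => unused; apply: exhausted; exists (h s); split=> // r rt.
    by move=> grt; apply: unused; exists r, rt.
  apply: (lt_small t); apply/card_le_setTP; exists k => [a b kab|s].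
    apply: h_inj; have [lt_a <-] := kP a; have [] := kP b.
    by rewrite -kab => lt_b <-; congr g; exact: Prop_irrelevance.
  by have [] := kP s.
exists f => [x y fxy|t]; last by have [] := fP t.
apply: contrapT => /lt_total[xy|yx].
- by have [_ /(_ x xy)] := fP y; apply.
- by have [_ /(_ y yx)] := fP x; apply.
Qed.

Lemma Bernstein_partition (I J X : Type) (K : J -> set X) (i0 : I) :
  (forall j, [set: J * I] #<= K j) ->
  exists A : I -> set X, [/\ trivIset [set: I] A,
    cover [set: I] A = [set: X] & forall i j, A i `&` K j !=set0].
Proof.
move=> K_large.
have [f f_inj fK] := exists_injective_choice (fun ji : J * I => K_large ji.1).
have /choice[label labelP] x : exists i, forall ji, f ji = x -> ji.2 = i.
  have [[ji fji]|nx] := pselect (exists ji, f ji = x).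
    by exists ji.2 => ji'; rewrite -fji => /f_inj ->.
  by exists i0 => ji fji; exfalso; apply: nx; exists ji.
exists (fun i => label @^-1` [set i]); split.
- by move=> i i' _ _ [x [/= <- <-]].
- by apply/seteqP; split=> // x _; exists (label x).
- move=> i j; exists (f (j, i)); split; last exact: fK (j, i).
  by rewrite /= -(labelP _ (j, i)).
Qed.

Lemma card_le_continuum_power (D : countType) (T : Type) :
  [set: T] #<= [set: continuum] -> [set: D -> T] #<= [set: continuum].
Proof.
move=> /card_le_setTP[code code_inj _]; apply/card_le_setTP.
exists (fun e k => if unpickle k is Some dn then code (e dn.1) dn.2 else false).
  move=> e e' ee'; apply/funext => d; apply/code_inj/funext => n.
  by have := congr1 (@^~ (pickle (d, n))) ee'; rewrite /= pickleK.
by [].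
Qed.

Lemma card_le_continuum_prod (S T : Type) :
  [set: S] #<= [set: continuum] -> [set: T] #<= [set: continuum] ->
  [set: S * T] #<= [set: continuum].
Proof.
move=> /card_le_setTP[f f_inj _] /card_le_setTP[g g_inj _].
apply: card_le_trans (card_le_continuum_power bool (card_lexx _)).
apply/card_le_setTP; exists (fun xy b => if b then f xy.1 else g xy.2) => //.
move=> [x y] [x' y'] fg.
by congr pair; [exact/f_inj/(congr1 (@^~ true) fg)
               |exact/g_inj/(congr1 (@^~ false) fg)].
Qed.

(** * The Cantor space *)

Lemma near_eq_mkseq (c : cantor_space) (n : nat) :
  \forall d \near c, mkseq d n = mkseq c n.
Proof.
elim: n => [|n IH]; first exact: (@nearW _ (nbhs c)).
have eq_nth : \forall d \near c, d n = c n.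
  exact: (@proj_continuous _ (fun=> bool) n c) (discrete_set1 (c n)).
by apply: filterS2 IH eq_nth => d dcs dcn; rewrite !mkseqS dcs dcn.
Qed.

Lemma cvg_nth_mkseq (c : cantor_space) :
  (fun n => nth false (mkseq c n) : cantor_space) @ \oo --> c.
Proof.
apply/cvg_sup => i U [V [[W oW <-] Wci VU]]; apply: (filterS VU).
by rewrite nbhs_simpl; exists i.+1 => // n /= lt_in; rewrite nth_mkseq.
Qed.

Lemma card_le_continuous_cantor (X : topologicalType) : hausdorff_space X ->
  [set: X] #<= [set: continuum] ->
  [set f : cantor_space -> X | continuous f] #<= [set: continuum].
Proof.
move=> hX cX; rewrite -(card_le_eql (card_setT _)).
apply: card_le_trans (card_le_continuum_power (seq bool) cX).
pose restrict (f : [set f : cantor_space -> X | continuous f]) s : X :=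
  set_val f (nth false s).
have restrict_cvg f c : (fun n => restrict f (mkseq c n)) @ \oo --> set_val f c.
  exact: cvg_comp (@cvg_nth_mkseq c) (set_valP f c).
apply/card_le_setTP; exists restrict => // f g fg; apply/val_inj/funext => c.
by apply: (cvg_unique hX (restrict_cvg f c)); rewrite fg; exact: restrict_cvg.
Qed.

Section branch_maps.
Context {X : topologicalType}.
Variables (N : seq bool -> set X) (f : cantor_space -> X).
Hypothesis fN : forall c n, N (mkseq c n) (f c).

Lemma branch_map_continuous :
  (forall c, filter_from [set: nat] (fun n => N (mkseq c n)) --> f c) ->
  continuous f.
Proof.
move=> N_cvg c O /N_cvg[n _ NO]; apply: filterS (near_eq_mkseq c n) => d dc.
by apply: NO; rewrite -dc; exact: fN.
Qed.

Lemma branch_map_injective :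
  (forall s, N (rcons s true) `&` N (rcons s false) = set0) -> injective f.
Proof.
move=> N_disj c d fcd.
suff prefix_eq n : mkseq c n = mkseq d n.
  apply/funext => n.
  by rewrite -(nth_mkseq false c (ltnSn n)) prefix_eq nth_mkseq.
elim: n => // n IH; have := fN c n.+1; have := fN d n.+1.
rewrite fcd !mkseqS IH; case: (c n) (d n) => -[]// Nd Nc;
  by have [] : set0 (f d) by rewrite -(N_disj (mkseq d n)).
Qed.

End branch_maps.

Lemma exists_binary_tree (T : Type) (A : set T)
    (P : nat -> T -> (bool -> T) -> Prop) (r : T) : A r ->
  (forall n t, A t -> exists2 u : bool -> T, forall b, A (u b) & P n t u) ->
  exists2 N : seq bool -> T, N [::] = r &
    forall s, A (N s) /\ P (size s) (N s) (fun b => N (rcons s b)).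
Proof.
move=> Ar exP.
have /choice[child childP] (nt : nat * T) : exists u : bool -> T,
    A nt.2 -> (forall b, A (u b)) /\ P nt.1 nt.2 u.
  have [/(exP nt.1)[u Au Pu]|nA] := pselect (A nt.2); first by exists u.
  by exists (fun=> r) => /nA.
pose M := fix M s := if s is b :: s' then child (size s', M s') b else r.
have AM s : A (M s) by elim: s => //= b s /(childP (size s, M s))[].
exists (M \o rev) => // s; split; first exact: AM.
have [_] := childP (size s, M (rev s)) (AM _).
by congr P; apply/funext => b; rewrite /= rev_rcons /= size_rev.
Qed.

(** * Pseudocomplete spaces *)

Definition nonempty_open {X : topologicalType} : set (set X) :=
  [set V | open V /\ V !=set0].

(* Only the open members of [B] matter. *)
Definition regular_pi_base {X : topologicalType} (B : set (set X)) : Prop :=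
  forall V, nonempty_open V ->
    exists W, [/\ nonempty_open W, closure W `<=` V & B W].

(* [W 0] is arbitrary: only the sets inside it are taken from the [B n]. *)
Definition nested_convergent {X : topologicalType}
    (B : nat -> set (set X)) : Prop :=
  forall W : nat -> set X, (forall n, nonempty_open (W n)) ->
    (forall n, closure (W n.+1) `<=` W n) -> (forall n, B n (W n.+1)) ->
  exists2 x, forall n, W n x & filter_from [set: nat] W --> x.

(* Oxtoby's pseudocompleteness, strengthened: nested sequences taken from the
   regular pi-bases have to converge to a point of their intersection, not just
   to have a nonempty intersection. *)
Definition strongly_pseudocomplete (X : topologicalType) : Prop :=
  exists2 B : nat -> set (set X),
    forall n, regular_pi_base (B n) & nested_convergent B.

Lemma nonempty_open_setD_nowhere_dense (X : topologicalType)
    (V F : set X) : nowhere_dense F -> nonempty_open V ->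
  nonempty_open (V `\` closure F).
Proof.
move=> F_nd [oV [x Vx]]; split.
  by apply: openI => //; apply: closed_openC; exact: closed_closure.
apply: contrapT => VF; suff : interior (closure F) x by rewrite F_nd.
apply: filterS (open_nbhs_nbhs (conj oV Vx)) => y Vy.
by apply: contrapT => nFy; apply: VF; exists y.
Qed.

Section crowded_hausdorff.
Context {X : topologicalType}.
Hypotheses (crX : crowded X) (hX : hausdorff_space X).

Lemma crowded_two_points (V : set X) : nonempty_open V ->
  exists x y, [/\ V x, V y & x != y].
Proof.
move=> [oV [x Vx]]; exists x; apply: contrapT => V_sub1.
suff : isolated [set: X] x by rewrite crX.
split; first by rewrite in_setT.
exists V; first exact: open_nbhs_nbhs.
rewrite setIT; apply/seteqP; split=> [y Vy|y ->]//=.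
apply: contrapT => yx; apply: V_sub1; exists y; split=> //.
by apply/eqP => xy; exact: yx.
Qed.

Lemma crowded_disjoint_opens (V : set X) : nonempty_open V ->
  exists2 W : bool -> set X, forall b, nonempty_open (W b) /\ W b `<=` V &
    W true `&` W false = set0.
Proof.
move=> V_no; have [x [y [Vx Vy xy]]] := crowded_two_points V_no.
have := hX; rewrite open_hausdorff => /(_ _ _ xy)[[O O']]/=.
rewrite !inE => -[Ox O'y] [oO oO' OO'].
exists (fun b => V `&` if b then O else O') => [b|].
  split; last exact: subIsetl.
  split; first by apply: openI; [exact: V_no.1|case: b].
  by case: b; [exists x|exists y].
by rewrite setIACA OO' setI0.
Qed.

Lemma exists_disjoint_refinement (B : set (set X)) (F V : set X) :
  regular_pi_base B -> nowhere_dense F -> nonempty_open V ->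
  exists2 W : bool -> set X, forall b, nonempty_open (W b) &
    [/\ forall b, closure (W b) `<=` V `\` F, forall b, B (W b) &
        W true `&` W false = set0].
Proof.
move=> B_base F_nd /(nonempty_open_setD_nowhere_dense F_nd).
move=> /crowded_disjoint_opens[O O_no O_disj].
have /choice[W WP] b := B_base (O b) (O_no b).1.
exists W => [b|]; first by have [] := WP b.
have WO b : W b `<=` O b.
  by have [_ /(subset_trans (@subset_closure _ _))] := WP b.
split=> [b|b|].
- have [_ + _] := WP b; move=> /subset_trans; apply.
  apply: subset_trans (O_no b).2 _; apply: setDS; exact: subset_closure.
- by have [] := WP b.
- by apply/seteqP; split=> // x [/WO Ox /WO O'x]; rewrite -O_disj.
Qed.

Lemma exists_cantor_embedding (U : set X) (F : nat -> set X) :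
  strongly_pseudocomplete X -> nonempty_open U ->
  (forall n, nowhere_dense (F n)) ->
  exists f : cantor_space -> X, [/\ continuous f, injective f &
    range f `<=` U `\` \bigcup_n F n].
Proof.
move=> [B B_base B_cvg] U_no F_nd.
have [n V V_no|N N0 NP] := @exists_binary_tree _ nonempty_open (fun n V W =>
    [/\ forall b, closure (W b) `<=` V `\` F n, forall b, B n (W b) &
        W true `&` W false = set0]) U U_no.
  exact: exists_disjoint_refinement.
have N_closure c n : closure (N (mkseq c n.+1)) `<=` N (mkseq c n) `\` F n.
  have [_ [+ _ _]] := NP (mkseq c n).
  by rewrite mkseqS size_mkseq; apply.
have /choice[f fP] c : exists x, (forall n, N (mkseq c n) x) /\
    filter_from [set: nat] (fun n => N (mkseq c n)) --> x.
  have [n|n|n|x] := B_cvg (fun n => N (mkseq c n)); last by exists x.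
  - by have [] := NP (mkseq c n).
  - exact: subset_trans (N_closure c n) (@subDsetl _ _ _).
  - have [_ [_ + _]] := NP (mkseq c n).
    by rewrite mkseqS size_mkseq; apply.
have fN c n : N (mkseq c n) (f c) by have [] := fP c.
exists f; split.
- by apply: branch_map_continuous fN _ => c; have [] := fP c.
- by apply: branch_map_injective fN _ => s; have [_ []] := NP s.
- move=> _ [c _ <-]; split; first by rewrite -N0; exact: fN c 0%N.
  by move=> [n _]; have [] := N_closure c n _ (subset_closure (fN c n.+1)).
Qed.

Theorem strongly_pseudocomplete_Baire_resolvable :
  strongly_pseudocomplete X -> [set: X] #<= [set: continuum] ->
  Baire_resolvable continuum X.
Proof.
move=> X_pc cX.
pose J : set (cantor_space -> X) := [set f | continuous f /\ injective f].
have J_card : [set: J * continuum] #<= [set: continuum].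
  apply: card_le_continuum_prod (card_lexx _).
  rewrite (card_le_eql (card_setT _)).
  apply: card_le_trans (card_le_continuous_cantor hX cX).
  by apply: subset_card_le => f [].
have [|A [A_disj A_cover A_meets]] := @Bernstein_partition continuum J X
    (fun f => range (set_val f)) (fun=> false).
  move=> f; apply: (card_le_trans J_card); apply/card_le_setTP.
  by exists (set_val f) => [|c]; [exact: (set_valP f).2|exists c].
exists A; split=> // i U oU U0 [F F_nd AU].
have [f [f_cont f_inj fU]] := exists_cantor_embedding X_pc (conj oU U0) F_nd.
have [x [Ax fx]] := A_meets i (SigSub (mem_set (conj f_cont f_inj) : f \in J)).
by have [Ux] := fU x fx; rewrite -AU; apply; split.
Qed.

End crowded_hausdorff.

(** * Locally compact and completely metrizable spaces *)

Lemma subset_nested_closures (X : topologicalType) (W : nat -> set X) :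
  (forall n, closure (W n.+1) `<=` W n) ->
  {homo W : m n / (m <= n)%N >-> n `<=` m}.
Proof.
move=> WS; apply: (@homo_leq _ _ (fun A B => B `<=` A)) => [A|B A C BA CB|n].
- exact: subset_refl.
- exact: subset_trans BA.
- exact: subset_trans (@subset_closure _ _) (WS n).
Qed.

Lemma nested_compact_closures_meet (X : topologicalType) (W : nat -> set X) :
  (forall n, W n !=set0) -> (forall n, closure (W n.+1) `<=` W n) ->
  compact (closure (W 1%N)) -> exists x, forall n, W n x.
Proof.
move=> W0 WS W1_compact; have W_mono := subset_nested_closures WS.
have W_filter : ProperFilter (filter_from [set: nat] W).
  apply: filter_from_proper => [|n _]; last exact: W0.
  apply: filter_from_filter; first by exists 0%N.
  move=> m n _ _; exists (maxn m n) => // x Wx.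
  by split; apply: W_mono Wx; rewrite ?leq_maxl ?leq_maxr.
have [|x [_ x_cluster]] := W1_compact _ W_filter.
  by exists 1%N => //; exact: subset_closure.
exists x => n; apply: WS; move: x_cluster; rewrite clusterE; apply.
by exists n.+1.
Qed.

Lemma second_countable_sequence (X : topologicalType) : @second_countable X ->
  exists2 B : nat -> set X, forall n, open (B n) &
    forall x O, nbhs x O -> exists2 n, B n x & B n `<=` O.
Proof.
move=> [Bs /countable_injP[f f_inj] [oBs Bs_base]].
exists (fun n => \bigcup_(U in [set U | Bs U /\ f U = n]) U).
  by move=> n; apply: bigcup_open => U [/oBs].
move=> x O /Bs_base[U [BU Ux] UO]; exists (f U); first by exists U.
move=> y [V [BV fVU] Vy]; apply: UO.
by rewrite -(f_inj V U)// ?inE.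
Qed.

Lemma card_le_continuum_second_countable (X : topologicalType) :
  kolmogorov_space X -> @second_countable X -> [set: X] #<= [set: continuum].
Proof.
move=> T0 /second_countable_sequence[B oB B_base].
apply/card_le_setTP; exists (fun x n => `[< B n x >]) => // x y xy.
have Bxy n : B n x <-> B n y by exact: asbool_eq_equiv (congr1 (@^~ n) xy).
apply/eqP/negPn/negP => /T0[O].
rewrite !inE/= => -[[/B_base[n Bnx BnO] nOy]|[/B_base[n Bny BnO] nOx]].
- exact/nOy/BnO/Bxy.
- exact/nOx/BnO/Bxy.
Qed.

Lemma locally_compact_hausdorff_shrink (X : topologicalType) (V : set X) :
  locally_compact [set: X] -> hausdorff_space X -> nonempty_open V ->
  exists W, [/\ nonempty_open W, closure W `<=` V & compact (closure W)].
Proof.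
move=> lcX hX [oV [x Vx]].
have [K] := @lcX x I; rewrite withinET => Kx [K_compact K_closed].
have [M Mx MV] := compact_regular hX K_compact Kx (open_nbhs_nbhs (conj oV Vx)).
exists (interior (M `&` K)); split.
- by split; [exact: open_interior|exists x; exact: filterI].
- apply: subset_trans MV; apply: closureS.
  by apply: subset_trans (@interior_subset _ _) _; exact: subIsetl.
- apply: subclosed_compact K_compact _; first exact: closed_closure.
  rewrite [X in _ `<=` X](closure_id K).1//; apply: closureS.
  by apply: subset_trans (@interior_subset _ _) _; exact: subIsetr.
Qed.

Definition decides {X : topologicalType} (O W : set X) : Prop :=
  W `<=` O \/ W `&` O = set0.

Lemma exists_deciding_nonempty_open (X : topologicalType) (O V : set X) :
  open O -> nonempty_open V ->
  exists W, [/\ nonempty_open W, W `<=` V & decides O W].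
Proof.
move=> oO [oV V0]; have [VO|VO] := pselect (V `&` O !=set0).
  exists (V `&` O); split; last by left; exact: subIsetr.
  - by split=> //; exact: openI.
  - exact: subIsetl.
by exists V; split=> //; right; apply/nonemptyPn.
Qed.

Lemma decidesS (X : topologicalType) (O V W : set X) :
  W `<=` V -> decides O V -> decides O W.
Proof.
move=> WV [VO|VO]; [left; exact: subset_trans VO|right].
by apply/seteqP; split=> // x [/WV Vx Ox]; rewrite -VO.
Qed.

Lemma locally_compact_second_countable_strongly_pseudocomplete
    (X : topologicalType) :
  locally_compact [set: X] -> hausdorff_space X -> @second_countable X ->
  strongly_pseudocomplete X.
Proof.
move=> lcX hX /second_countable_sequence[O oO O_base].
exists (fun n => [set W | compact (closure W) /\ decides (O n) W]).
  move=> n V /(exists_deciding_nonempty_open (oO n))[V' [V'_no V'V V'O]].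
  have [W [W_no WV' W_compact]] :=
    locally_compact_hausdorff_shrink lcX hX V'_no.
  exists W; split=> //; first exact: subset_trans V'V.
  split=> //; apply: decidesS V'O.
  exact: subset_trans (@subset_closure _ _) WV'.
move=> W W_no WS W_good.
have [x Wx] := nested_compact_closures_meet (fun n => (W_no n).2) WS
  (W_good 0%N).1.
exists x => // U /O_base[n Onx OnU]; exists n.+1 => //.
have [_ [|WO]] := W_good n; first by move/subset_trans; apply.
by suff : set0 x by []; rewrite -WO.
Qed.

Local Open Scope ring_scope.

Section compatible_metric.
Context {R : realType} {X : topologicalType}.
Variable d : X -> X -> R.
Hypotheses (md : is_metric d) (td : metric_induces_topology d).

Lemma metric_open_ball (x : X) (e : R) : open [set y | d x y < e].
Proof.
have [_ _ _ d_tri] := md; apply/td => y /= xy.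
exists (e - d x y); first by rewrite subr_gt0.
by move=> z /= yz; have := d_tri x y z; lra.
Qed.

Lemma metric_nbhs_ball (x : X) (e : R) : 0 < e -> nbhs x [set y | d x y < e].
Proof.
have [_ d0 _ _] := md; move=> e0; apply: open_nbhs_nbhs.
by split; [exact: metric_open_ball|rewrite /= (d0 x x).2].
Qed.

Lemma metric_nbhs_sub_ball (x : X) (O : set X) :
  nbhs x O -> exists2 e, 0 < e & [set y | d x y < e] `<=` O.
Proof.
rewrite nbhsE => -[U [oU Ux] UO]; have [e e0 eU] := (td U).1 oU x Ux.
by exists e => //; exact: subset_trans UO.
Qed.

Lemma metric_hausdorff : hausdorff_space X.
Proof.
have [d_ge0 d0 d_sym d_tri] := md.
move=> x y xy; apply/d0/eqP; rewrite eq_le d_ge0 andbT leNgt.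
apply/negP => dxy; have half_gt0 : 0 < d x y / 2 by rewrite divr_gt0.
have [z [/= xz yz]] :=
  xy _ _ (metric_nbhs_ball x half_gt0) (metric_nbhs_ball y half_gt0).
by have := d_tri x z y; rewrite (d_sym z y); lra.
Qed.

Definition diameter_lt (e : R) : set (set X) :=
  [set W | forall x y, W x -> W y -> d x y < e].

Lemma regular_pi_base_diameter_lt (e : R) : 0 < e ->
  regular_pi_base (diameter_lt e).
Proof.
have [_ d0 d_sym d_tri] := md.
move=> e0 V [oV [x Vx]]; have [e' e'0 e'V] := (td V).1 oV x Vx.
pose r := Num.min e e' / 2.
have [r0 re re'] : [/\ 0 < r, 2 * r <= e & 2 * r <= e'].
  have : 0 < Num.min e e' by rewrite lt_min e0.
  have : Num.min e e' <= e by rewrite ge_min lexx.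
  have : Num.min e e' <= e' by rewrite ge_min lexx orbT.
  by rewrite /r; split; lra.
exists [set y | d x y < r]; split.
- split; first exact: metric_open_ball.
  by exists x; rewrite /= (d0 x x).2.
- move=> y /(_ _ (metric_nbhs_ball y r0))[z [/= xz yz]].
  by apply: e'V => /=; have := d_tri x z y; rewrite (d_sym z y); lra.
- by move=> y z /= xy xz; have := d_tri y x z; rewrite (d_sym y x); lra.
Qed.

Lemma nested_convergent_diameter_lt : metric_complete d ->
  nested_convergent (fun n => diameter_lt n.+1%:R^-1).
Proof.
have [_ _ d_sym _] := md.
move=> d_complete W W_no WS W_small; have W_mono := subset_nested_closures WS.
have inv_lt (e : R) : 0 < e -> exists n : nat, n.+1%:R^-1 < e.
  by move=> /ltr_add_invr[n]; rewrite add0r; exists n.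
have [u uW] := choice (fun n => (W_no n).2).
have [|x ux] := d_complete u.
  move=> e /inv_lt[n ne]; exists n.+1 => p q np nq; apply: lt_trans ne.
  by apply: (W_small n); [exact: W_mono np _ _|exact: W_mono nq _ _].
have Wx n : W n x.
  apply: WS => O /metric_nbhs_sub_ball[e e0 eO]; have [N uN] := ux e e0.
  exists (u (maxn N n.+1)); split; first exact: W_mono (leq_maxr _ _) _ _.
  by apply: eO => /=; rewrite d_sym; apply: uN; exact: leq_maxl.
exists x => // O /metric_nbhs_sub_ball[e /inv_lt[n ne] eO].
exists n.+1 => // y Wy; apply: eO => /=; apply: lt_trans ne.
exact: W_small.
Qed.

End compatible_metric.

Lemma completely_metrizable_hausdorff (R : realType) (X : topologicalType) :
  completely_metrizable R X -> hausdorff_space X.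
Proof. by move=> [d [md td _]]; exact: metric_hausdorff md td. Qed.

Lemma completely_metrizable_strongly_pseudocomplete
    (R : realType) (X : topologicalType) :
  completely_metrizable R X -> strongly_pseudocomplete X.
Proof.
move=> [d [md td d_complete]]; exists (fun n => diameter_lt d n.+1%:R^-1).
  by move=> n; apply: regular_pi_base_diameter_lt => //; rewrite invr_gt0 ltr0n.
exact: nested_convergent_diameter_lt.
Qed.

Theorem theorem4p15 (R : realType) (X : topologicalType) :
  crowded X ->
  [/\ locally_compact [set: X], hausdorff_space X & @second_countable X] \/
  (completely_metrizable R X /\ has_card_continuum X) ->
  Baire_resolvable continuum X.
Proof.
move=> crX [[lcX hX scX]|[cmX cX]].
- apply: strongly_pseudocomplete_Baire_resolvable => //.
  + exact: locally_compact_second_countable_strongly_pseudocomplete.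
  + apply: card_le_continuum_second_countable => //.
    exact/accessible_kolmogorov/hausdorff_accessible.
- apply: strongly_pseudocomplete_Baire_resolvable => //.
  + exact: completely_metrizable_hausdorff cmX.
  + exact: completely_metrizable_strongly_pseudocomplete cmX.
  + by have /card_eqPle[] := cX.
Qed.
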